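(* There exist constants $c,C_1,C_2,C_3>0$ that do not depend on $\alpha,X,\sigma,L$ such that the following holds. Let $\alpha\ge1$, let $0<\sigma\le L$, and let $X$ be a mean-zero real random variable with $$\mathbb E|X|^k\le k^{\frac k\alpha}\sigma^2L^{k-2}\quad\text{for all integers }k\ge2.$$ For $\alpha>1$ let $\beta$ satisfy $\frac1\alpha+\frac1\beta=1$. 1. When $\alpha\ge2$: $\mathbb E\exp(\lambda X)\le\exp(C_1\lambda^2\sigma^2)$ for all $0\le\lambda\le\frac cL$, and $\mathbb E\exp(\lambda X)\le\exp\left(C_2\min\{\lambda^\beta L^\beta,\lambda^2L^2\}\right)$ for all $\lambda\ge0$. 2. When $1<\alpha\le2$: $\mathbb E\exp(\lambda X)\le\exp(C_1\lambda^2\sigma^2)$ for all $0\le\lambda\le\frac cL$, and, for any constant $\tau\in(0,1)$, $\mathbb E\exp(\lambda X)\le\exp\left(C_3^\beta\frac{\tau^{-[\beta]-1}}{1-\tau}\lambda^\beta L^\beta\right)$ for all $\lambda\ge\frac{c\tau}L$. 3. When $\alpha=1$: $\mathbb E\exp(\lambda X)\le\exp(C_1\lambda^2\sigma^2)$ for all $0\le\lambda\le\frac cL$.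
   Context: $[a]$ denotes the largest integer not exceeding $a$. *)

(* Defs.v *)
From HB Require Import structures.
From mathcomp Require Export all_boot all_order all_algebra.
From mathcomp Require Export all_classical all_reals all_analysis.
Export Order.TTheory GRing.Theory Num.Theory numFieldNormedType.Exports.

(* Main.v *)
Require Import Defs.
From mathcomp Require Import all_boot all_order all_algebra.
From mathcomp Require Import all_classical all_reals all_analysis.
From mathcomp Require Import measurable_realfun ring lra.
Import Order.TTheory GRing.Theory Num.Theory numFieldNormedType.Exports.
Local Open Scope classical_set_scope.
Local Open Scope ring_scope.

(** Write e for Euler's number and u = lambda L.  As X is centred, the linear
    term of the exponential series drops out, so bounding the other terms in
    absolute value gives
      E exp(lambda X) <= 1 + sum_(k >= 2) lambda^k E|X|^k / k!
                      <= 1 + (sigma/L)^2 sum_(k >= 2) u^k k^(k/alpha) / k!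
    ([mgf_le_moment_series], [mgf_le_normalized_series]).  The two regimes
    bound this last series in two ways.

    For e u <= 1/2 the inequality k^(k/alpha) <= k^k <= e^k k! makes the series
    geometric with sum at most 2 (e u)^2, which yields the Gaussian bound with
    C1 = 2 e^2 and c = 1/(2e) ([mgf_gaussian_regime]).

    For 2 e u >= 1 let beta be the conjugate exponent of alpha.  Then
    k^(k/alpha)/k! <= e^k k^(-k/beta), so that the k-th term is at most
    2^(-k) y with y = (2 e u)^k k^(-k/beta).  Since y <= 1 + y^beta and
    y^beta = W^k / k^k <= W^k / k! for W = (2 e u)^beta, the terms are bounded
    by 2^(-k) + W^k / k!: the sum is at most 2 + exp W, and W >= 1 turns
    3 + exp W into exp(3 W) ([conjugate_term_le], [mgf_conjugate_regime]).
    The exponent beta enters only through W, so one estimate serves every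
    alpha > 1, with no loss as beta tends to infinity.

    The claims for large lambda are then elementary.  If alpha >= 2, then
    beta <= 2 and W <= 4 e^2 min(u^beta, u^2), whence C2 = 12 e^2, the
    Gaussian bound being stronger than needed when u <= c <= 1.  If
    alpha <= 2, then beta >= 2 and 3 W <= (6 e u)^beta, whence C3 = 6 e; on the
    remaining range c tau <= u <= c the Gaussian bound is itself below the
    claimed one, because the factor tau^(-[beta]-1)/(1-tau) makes up for
    u^(beta-2) being as small as (c tau)^(beta-2) ([sq_le_tau_powR]). *)

Set Implicit Arguments.
Unset Strict Implicit.
Unset Printing Implicit Defensive.

(** * Moment series and the moment generating function *)

Lemma cvg_expR_tail (R : realType) (y : R) :
  (fun n => \sum_(0 <= i < n) y ^+ i.+2 / i.+2`!%:R) @ \oo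
    --> expR y - 1 - y.
Proof.
have : series (exp_coeff y) @ \oo --> expR y by exact: is_cvg_series_exp_coeff.
rewrite -(cvg_shiftn 2) => cvgS.
have -> : (fun n => \sum_(0 <= i < n) y ^+ i.+2 / i.+2`!%:R) =
    (fun n => series (exp_coeff y) (n + 2)%N - 1 - y).
  apply/funext => n; rewrite /series /= addn2 !big_nat_recl//= /exp_coeff /=.
  by rewrite expr0 expr1 !divr1; ring.
by apply: cvgB; [apply: cvgB => //|]; exact: cvg_cst.
Qed.

(** The comparison is termwise and starts at order 2: the linear term keeps its
    sign, so that it vanishes in expectation for a centred variable. *)
Lemma expR_tail_le_norm (R : realType) (y : R) :
  expR y - 1 - y <= expR `|y| - 1 - `|y|.
Proof.
apply: (ler_cvg_to (@cvg_expR_tail R _) (@cvg_expR_tail R _)).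
apply: nearW => n; apply: ler_sum => i _.
rewrite ler_pM2r ?invr_gt0 ?ltr0n ?fact_gt0//.
by rewrite (le_trans (ler_norm _))// normrX.
Qed.

Section mgf.
Context (R : realType) (d : measure_display) (T : measurableType d).
Variables (P : probability T R) (X : {RV P >-> R}).

Lemma integrable_of_second_moment :
  ('E_P[fun w => (`|X w| ^+ 2)%R] < +oo)%E -> P.-integrable setT (EFin \o X).
Proof.
rewrite unlock => X2.
have mX : measurable_fun setT X by [].
(* |x| <= 1 + x^2 transfers integrability from the second moment to X. *)
have iX2 : P.-integrable setT (EFin \o (fun w => 1 + `|X w| ^+ 2)).
  rewrite (_ : _ \o _ = ((cst 1%:E) \+ (fun w => (`|X w| ^+ 2)%:E))%E) //.
  apply: integrableD => //.
    exact: finite_measure_integrable_cst.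
  apply/integrableP; split.
    apply/measurable_EFinP; apply: measurable_funX.
    exact: measurableT_comp.
  apply: le_lt_trans X2; rewrite le_eqVlt; apply/orP; left; apply/eqP.
  by apply: eq_integral => w _ /=; rewrite ger0_norm.
apply: le_integrable iX2 => //; first exact/measurable_EFinP.
move=> w _ /=; rewrite lee_fin.
rewrite [leRHS]ger0_norm ?addr_ge0//.
by have := normr_ge0 (X w); nra.
Qed.

(** Only the terms of order at least 2 are replaced by absolute moments: they
    form the nonnegative function G, which monotone convergence integrates
    term by term, while the affine part 1 + lambda X has integral 1. *)
Lemma mgf_le_moment_series (m : nat -> R) (lambda B : R) :
  ('E_P[X] = 0)%E -> 0 <= lambda ->
  (forall k, (2 <= k)%N -> ('E_P[fun w => (`|X w| ^+ k)%R] <= (m k)%:E)%E) ->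
  (forall n, \sum_(0 <= i < n) lambda ^+ i.+2 * m i.+2 / i.+2`!%:R <= B) ->
  ('E_P[fun w => expR (lambda * X w)] <= (1 + B)%:E)%E.
Proof.
move=> EX0 lambda0 EXk leB.
have mX : measurable_fun setT X by [].
have iX : P.-integrable setT (EFin \o X).
  apply: integrable_of_second_moment.
  by apply: le_lt_trans (EXk 2%N isT) _; rewrite ltry.
pose Y w : R := `|lambda * X w|.
have mY : measurable_fun setT Y.
  by apply: measurableT_comp => //; exact: measurable_funM.
pose f i w : R := Y w ^+ i.+2 / i.+2`!%:R.
have mf i : measurable_fun setT (f i).
  by apply: measurable_funM => //; exact: measurable_funX.
have f0 i w : 0 <= f i w by rewrite /f divr_ge0 ?exprn_ge0 ?normr_ge0 ?ler0n.
have fB i : (\int[P]_w (f i w)%:E <=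
    (lambda ^+ i.+2 * m i.+2 / i.+2`!%:R)%:E)%E.
  have -> : (\int[P]_w (f i w)%:E = \int[P]_w
      ((lambda ^+ i.+2 / i.+2`!%:R)%:E * (`|X w| ^+ i.+2)%:E))%E.
    apply: eq_integral => w _; rewrite -EFinM /f /Y normrM exprMn.
    by rewrite (ger0_norm lambda0) mulrAC.
  rewrite ge0_integralZl_EFin//; last 2 first.
  - apply/measurable_EFinP; apply: measurable_funX; exact: measurableT_comp.
  - by rewrite divr_ge0 ?exprn_ge0.
  have := EXk i.+2 isT; rewrite unlock => h.
  rewrite [X in (_ <= X%:E)%E]mulrAC [leRHS]EFinM.
  by apply: lee_wpmul2l h; rewrite lee_fin divr_ge0 ?exprn_ge0 ?ler0n.
pose G w : R := expR (Y w) - 1 - Y w.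
have mG : measurable_fun setT G.
  apply: measurable_funB => //; apply: measurable_funB => //.
  exact: measurableT_comp.
have G0 w : 0 <= G w.
  by rewrite /G -addrA -opprD subr_ge0 expR_ge1Dx.
have intG : (\int[P]_w (G w)%:E <= B%:E)%E.
  pose S n w : R := \sum_(0 <= i < n) f i w.
  have mS n : measurable_fun setT (S n) by exact: measurable_sum.
  have ndS w : nondecreasing_seq (S ^~ w).
    by apply/nondecreasing_seqP => n; rewrite /S big_nat_recr//= lerDl.
  have -> : (\int[P]_w (G w)%:E = \int[P]_w limn (fun n => (S n w)%:E))%E.
    apply: eq_integral => w _; apply/esym/cvg_lim => //.
    by apply: cvg_EFin; [exact: nearW|exact: cvg_expR_tail].
  rewrite monotone_convergence//; last 3 first.
  - by move=> n; exact/measurable_EFinP.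
  - by move=> n w _; rewrite lee_fin sumr_ge0.
  - by move=> w _ n p np; rewrite lee_fin ndS.
  apply: lime_le.
    apply: ereal_nondecreasing_is_cvgn => n p np; apply: ge0_le_integral => //.
    - by move=> w _; rewrite lee_fin sumr_ge0.
    - exact/measurable_EFinP.
    - exact/measurable_EFinP.
    - by move=> w _; rewrite lee_fin ndS.
  apply: nearW => n.
  apply: (@le_trans _ _
    (\sum_(0 <= i < n) lambda ^+ i.+2 * m i.+2 / i.+2`!%:R)%:E); last first.
    by rewrite lee_fin.
  under eq_integral do rewrite /S -sumEFin.
  rewrite ge0_integral_sum//; last 2 first.
  - by move=> i; exact/measurable_EFinP.
  - by move=> i w _; rewrite lee_fin.
  by rewrite -sumEFin; exact: lee_sum.
have iG : P.-integrable setT (EFin \o G).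
  apply/integrableP; split; first exact/measurable_EFinP.
  apply: (@le_lt_trans _ _ (\int[P]_w (G w)%:E)%E).
    rewrite le_eqVlt; apply/orP; left; apply/eqP.
    by apply: eq_integral => w _ /=; rewrite ger0_norm.
  by rewrite (le_lt_trans intG) ?ltry.
have iXG : P.-integrable setT (EFin \o (fun w => 1 + lambda * X w)).
  rewrite (_ : _ \o _ = ((cst 1%:E) \+ (fun w => lambda%:E * (X w)%:E))%E) //.
  apply: integrableD => //; first exact: finite_measure_integrable_cst.
  exact: integrableZl.
rewrite unlock.
apply: (@le_trans _ _ (\int[P]_w ((1 + lambda * X w)%:E + (G w)%:E))%E).
  apply: ge0_le_integral => //.
  - apply/measurable_EFinP; apply: measurableT_comp => //.
    exact: measurable_funM.
  - apply: emeasurable_funD; first exact: measurable_int iXG.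
    exact: measurable_int iG.
  - move=> w _; rewrite -EFinD lee_fin.
    by have := expR_tail_le_norm (lambda * X w); rewrite -/(Y w) /G; lra.
rewrite integralD// EFinD; apply: leeD => //.
under eq_integral do rewrite EFinD EFinM.
rewrite integralD//; last 2 first.
- exact: finite_measure_integrable_cst.
- exact: integrableZl.
have -> : (\int[P]_w (cst 1%:E w) = 1)%E.
  by have := expectation_cst P 1; rewrite unlock.
rewrite integralZl//.
by move: EX0; rewrite unlock => ->; rewrite mule0 adde0.
Qed.
End mgf.

(** * Bounds for the series of moment bounds *)

Section series.
Context {R : realType}.
Implicit Types (x u alpha beta W : R).

(** One term of the exponential series at k: a Stirling-type bound that is
    sharp up to a factor of order sqrt k. *)
Lemma selfpow_div_fact_le (k : nat) :
  k%:R ^+ k / k`!%:R <= expR 1 ^+ k :> R.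
Proof.
case: k => [|k]; first by rewrite !expr0 divr1.
rewrite -expRM_natr mul1r.
have := @expR_ge1Dxn R k.+1%:R k (ler0n _ _); lra.
Qed.

Lemma fact_le_selfpow (k : nat) : k`!%:R <= k%:R ^+ k :> R.
Proof.
rewrite -natrX ler_nat; elim: k => // k IH.
rewrite factS expnS leq_mul2l /=.
by rewrite (leq_trans IH)//; case: k {IH} => // k; rewrite leq_exp2r.
Qed.

Lemma sum_geometric_le2 x (n : nat) : 0 <= x -> x <= 2^-1 ->
  \sum_(0 <= i < n) x ^+ i <= 2.
Proof.
move=> x0 x2.
have h : (1 - x) * \sum_(0 <= i < n) x ^+ i <= 1.
  rewrite big_mkord -opprB mulNr -subrX1 opprB lerBlDr lerDl exprn_ge0//.
have S0 : 0 <= \sum_(0 <= i < n) x ^+ i.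
  by apply: sumr_ge0 => i _; exact: exprn_ge0.
nra.
Qed.

Lemma sum_exp_coeff_le W (n : nat) : 0 <= W ->
  \sum_(0 <= i < n) W ^+ i / i`!%:R <= expR W.
Proof.
move=> W0; rewrite /expR.
apply: (nondecreasing_cvgn_le _ (is_cvg_series_exp_coeff W) n).
apply/nondecreasing_seqP => k.
by rewrite /series /= big_nat_recr //= lerDl exp_coeff_ge0.
Qed.

Lemma moment_term_le_expR1X alpha (k : nat) : 1 <= alpha -> (0 < k)%N ->
  k%:R `^ (k%:R / alpha) / k`!%:R <= expR 1 ^+ k :> R.
Proof.
move=> a1 k0; apply: le_trans (selfpow_div_fact_le k).
rewrite ler_pM2r ?invr_gt0 ?ltr0n ?fact_gt0// -powR_mulrn//.
apply: ler_powR; first by rewrite ler1n.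
by rewrite ler_piMr// invf_le1//; lra.
Qed.

Lemma moment_sum_le_geometric alpha u (n : nat) :
  1 <= alpha -> 0 <= u -> expR 1 * u <= 2^-1 ->
  \sum_(0 <= i < n) u ^+ i.+2 * i.+2%:R `^ (i.+2%:R / alpha) / i.+2`!%:R
    <= 2 * (expR 1 * u) ^+ 2.
Proof.
move=> a1 u0 u2.
have eu0 : 0 <= expR 1 * u by rewrite mulr_ge0// expR_ge0.
apply: (@le_trans _ _
  (\sum_(0 <= i < n) (expR 1 * u) ^+ i * (expR 1 * u) ^+ 2)).
  apply: ler_sum => i _; rewrite -exprD addn2 exprMn mulrC mulrCA mulrC.
  by rewrite ler_wpM2r ?exprn_ge0// mulrC moment_term_le_expR1X.
rewrite -mulr_suml ler_wpM2r ?exprn_ge0//.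
exact: sum_geometric_le2.
Qed.

(** The factor 2^(-k) is taken out before y <= 1 + y^beta is applied, so that
    the constant 1 becomes summable at the cost of a 2 in the base of the power
    beta. *)
Lemma conjugate_term_le alpha beta u (k : nat) :
  1 <= alpha -> 0 < beta -> alpha^-1 + beta^-1 = 1 -> 0 <= u -> (0 < k)%N ->
  u ^+ k * k%:R `^ (k%:R / alpha) / k`!%:R <=
    2^-1 ^+ k + ((2 * expR 1 * u) `^ beta) ^+ k / k`!%:R.
Proof.
move=> a1 b0 ab u0 k0.
have kR0 : 0 < k%:R :> R by rewrite ltr0n.
have fk0 : 0 < k`!%:R :> R by rewrite ltr0n fact_gt0.
have b1 : 1 <= beta.
  rewrite -(@lef_pV2 _ beta 1) ?posrE// invr1.
  have : 0 < alpha^-1 by rewrite invr_gt0; lra.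
  lra.
set W := (2 * expR 1 * u) `^ beta.
have eu0 : 0 <= 2 * expR 1 * u by rewrite !mulr_ge0// expR_ge0.
(* y is chosen so that the k-th term is at most 2^(-k) y. *)
pose y : R := (2 * expR 1 * u) ^+ k / k%:R `^ (k%:R / beta).
have y0 : 0 <= y by rewrite divr_ge0 ?exprn_ge0 ?powR_ge0.
have yb : y `^ beta = W ^+ k / k%:R ^+ k.
  have pow_swap : ((2 * expR 1 * u) ^+ k) `^ beta = W ^+ k.
    by rewrite -!powR_mulrn ?powR_ge0// powRAC.
  rewrite /y powRM ?exprn_ge0 ?invr_ge0 ?powR_ge0// pow_swap; congr (_ * _).
  rewrite -powRN -powRrM -powR_invn ?ltW//; congr (_ `^ _).
  by field; rewrite gt_eqF.
have y1 : y <= 1 + y `^ beta.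
  have := powR_ge0 y beta.
  have [y1|y1] := leP y 1; first by lra.
  have := le1r_powR (ltW y1) b1; lra.
apply: (@le_trans _ _ (2^-1 ^+ k * y)).
  have -> : k%:R / alpha = k%:R - k%:R / beta :> R.
    have -> : alpha^-1 = 1 - beta^-1 by rewrite -ab addrK.
    by rewrite mulrBr mulr1.
  rewrite powRB; last by rewrite [k%:R == 0]gt_eqF//= implybT.
  rewrite powR_mulrn; last exact: ltW.
  rewrite /y.
  have -> : 2^-1 ^+ k * ((2 * expR 1 * u) ^+ k / k%:R `^ (k%:R / beta)) =
     u ^+ k / k%:R `^ (k%:R / beta) * expR 1 ^+ k.
    rewrite mulrA -exprMn !mulrA mulVf// mul1r exprMn; ring.
  have -> : u ^+ k * (k%:R ^+ k / k%:R `^ (k%:R / beta)) / k`!%:R =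
     u ^+ k / k%:R `^ (k%:R / beta) * (k%:R ^+ k / k`!%:R) by ring.
  apply: ler_wpM2l; first by rewrite divr_ge0 ?exprn_ge0 ?powR_ge0.
  exact: selfpow_div_fact_le.
apply: (@le_trans _ _ (2^-1 ^+ k * (1 + y `^ beta))).
  by rewrite ler_wpM2l// exprn_ge0// invr_ge0.
rewrite mulrDr mulr1 lerD2l yb.
apply: (@le_trans _ _ (W ^+ k / k%:R ^+ k)).
  rewrite ler_piMl ?exprn_ile1 ?invf_le1 ?ler1n//.
  by rewrite divr_ge0 ?exprn_ge0 ?powR_ge0.
rewrite ler_wpM2l ?exprn_ge0 ?powR_ge0// lef_pV2 ?posrE//.
  exact: fact_le_selfpow.
by rewrite exprn_gt0.
Qed.
End series.

(** * The Gaussian and the conjugate-exponent regimes *)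

Section moment_growth.
Context (R : realType) (d : measure_display) (T : measurableType d).
Context (P : probability T R) (X : {RV P >-> R}) (alpha sigma L : R).
Context (a1 : 1 <= alpha) (s0 : 0 < sigma) (sL : sigma <= L).
Context (EX0 : ('E_P[X] = 0)%E).
Context (EXk : forall k : nat, (2 <= k)%N ->
  ('E_P[fun w => (`|X w| ^+ k)%R] <=
    (k%:R `^ (k%:R / alpha) * sigma ^+ 2 * L ^+ (k - 2))%:E)%E).

Let e : R := expR 1.
Let e0 : 0 < e := expR_gt0 1.
Let L0 : 0 < L := lt_le_trans s0 sL.

(** The moment hypothesis is homogeneous: after scaling by L it only depends
    on lambda L and on the ratio sigma / L, which is at most 1. *)
Lemma mgf_le_normalized_series (lambda B : R) : 0 <= lambda ->
  (forall n, \sum_(0 <= i < n) (lambda * L) ^+ i.+2 *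
     i.+2%:R `^ (i.+2%:R / alpha) / i.+2`!%:R <= B) ->
  ('E_P[fun w => expR (lambda * X w)] <= (1 + (sigma / L) ^+ 2 * B)%:E)%E.
Proof.
move=> l0 leB.
apply: (mgf_le_moment_series EX0 l0 EXk) => n.
apply: le_trans (ler_wpM2l (sqr_ge0 (sigma / L)) (leB n)).
rewrite mulr_sumr; apply: ler_sum => i _.
rewrite subSS subSS subn0 le_eqVlt; apply/orP; left; apply/eqP.
rewrite -[i.+2]addn2 !exprD addn2 !exprMn.
by field; rewrite !gt_eqF// ltr0n fact_gt0.
Qed.

Lemma mgf_gaussian_regime (lambda : R) :
  0 <= lambda -> lambda <= (2 * e)^-1 / L ->
  ('E_P[fun w => expR (lambda * X w)] <=
     (expR (2 * e ^+ 2 * lambda ^+ 2 * sigma ^+ 2))%:E)%E.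
Proof.
move=> l0 lc.
have u0 : 0 <= lambda * L by rewrite mulr_ge0// ltW.
have eu : e * (lambda * L) <= 2^-1.
  rewrite ler_pdivlMr// in lc.
  have -> : 2^-1 = e * (2 * e)^-1 by field; rewrite gt_eqF.
  by rewrite ler_pM2l.
have := mgf_le_normalized_series l0
  (fun n => moment_sum_le_geometric n a1 u0 eu).
move/le_trans; apply; rewrite lee_fin.
have -> : (sigma / L) ^+ 2 * (2 * (expR 1 * (lambda * L)) ^+ 2) =
    2 * e ^+ 2 * lambda ^+ 2 * sigma ^+ 2.
  by rewrite /e; field; rewrite gt_eqF.
exact: expR_ge1Dx.
Qed.

(** The hypothesis on lambda says that 2 e lambda L >= 1; the exponent is
    therefore at least 3, which absorbs the additive constant of the bound
    3 + exp W with W = (2 e lambda L)^beta. *)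
Lemma mgf_conjugate_regime (beta lambda : R) :
  0 < beta -> alpha^-1 + beta^-1 = 1 ->
  (2 * e)^-1 / L <= lambda ->
  ('E_P[fun w => expR (lambda * X w)] <=
     (expR (3 * (2 * e * (lambda * L)) `^ beta))%:E)%E.
Proof.
move=> b0 ab cl.
have l0 : 0 <= lambda.
  by apply: le_trans cl; rewrite divr_ge0 ?invr_ge0 ?mulr_ge0 ?ltW.
have u0 : 0 <= lambda * L by rewrite mulr_ge0// ltW.
have v1 : 1 <= 2 * e * (lambda * L).
  rewrite ler_pdivrMr// in cl.
  by rewrite -ler_pdivrMl ?mulr_gt0// mulr1.
set W := (2 * e * (lambda * L)) `^ beta.
have W1 : 1 <= W by rewrite -(powRr0 (2 * e * (lambda * L))) ler_powR// ltW.
have sumB n : \sum_(0 <= i < n) (lambda * L) ^+ i.+2 *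
     i.+2%:R `^ (i.+2%:R / alpha) / i.+2`!%:R <= 2 + expR W.
  apply: (@le_trans _ _
    (\sum_(0 <= i < n) (2^-1 ^+ i + W ^+ i.+2 / i.+2`!%:R))).
    apply: ler_sum => i _.
    apply: le_trans (conjugate_term_le a1 b0 ab u0 (ltn0Sn i.+1)) _.
    by rewrite lerD2r ler_wiXn2l ?invr_ge0 ?invf_le1 ?ler1n// -addn2 leq_addr.
  rewrite big_split /=; apply: lerD.
    by apply: sum_geometric_le2; lra.
  have W0 : 0 <= W by lra.
  apply: le_trans (sum_exp_coeff_le n.+2 W0).
  (* the moment series lacks the terms 1 and W of the exponential series *)
  rewrite [leRHS]big_nat_recl// [in leRHS]big_nat_recl//= addrA lerDr.
  by rewrite expr0 expr1 !divr1; lra.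
have := mgf_le_normalized_series l0 sumB.
move/le_trans; apply; rewrite lee_fin.
have r1 : (sigma / L) ^+ 2 <= 1.
  rewrite expr_le1// ?ler_pdivrMr ?mul1r//.
  by rewrite divr_ge0 ?ltW.
have eW := expR_ge1Dx W.
(* 3 + z <= z^3 with z = exp W >= 2 *)
have -> : expR (3 * W) = expR W ^+ 3 by rewrite expRM_natl.
rewrite !exprS expr0 mulr1.
have e2 : 2 <= expR W by lra.
have : (sigma / L) ^+ 2 * (2 + expR W) <= 2 + expR W.
  by rewrite ler_piMl//; lra.
have : 4 * expR W <= expR W * (expR W * expR W).
  by rewrite [leRHS]mulrC ler_pM2r ?expR_gt0//; nra.
lra.
Qed.
End moment_growth.

(** * Comparison of the exponents *)

Lemma conjugate_exponent_gt0 (R : realType) (alpha beta : R) :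
  1 < alpha -> alpha^-1 + beta^-1 = 1 -> 0 < beta.
Proof.
move=> a1 ab; rewrite -invr_gt0.
have : alpha^-1 < 1 by rewrite invf_lt1//; lra.
lra.
Qed.

(** A power of tau < 1 with exponent - [beta] - 1 + s is at least 1 as soon as
    this exponent is nonpositive, that is, when s <= [beta] + 1; dividing by
    1 - tau < 1 only increases it. *)
Lemma tau_factor_ge1 (R : realType) (tau beta s : R) :
  0 < tau -> tau < 1 -> s <= beta ->
  1 <= tau ^ (- Num.floor beta - 1) / (1 - tau) * tau `^ s.
Proof.
move=> t0 t1 sb.
have tk : 1 <= tau ^ (- Num.floor beta - 1) * tau `^ s.
  rewrite -powR_intmul ?(ltW t0)// -powRD ?[tau == 0]gt_eqF ?implybT//.
  rewrite -[leLHS](powRr0 tau) ger_powR//; first by rewrite t0 ltW.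
  have := floorD1_gt beta; rewrite !(intrD, intrN, rmorphB) /=; lra.
rewrite mulrAC (le_trans tk)// ler_peMr//; first by lra.
by rewrite invf_ge1; lra.
Qed.

(** Both sides carry C^2 u^2; what remains on the right is the product of
    (C u)^(beta - 2) >= (C c)^(beta - 2) tau^(beta - 2) with the factor in tau,
    and the latter compensates tau^(beta - 2). *)
Lemma sq_le_tau_powR (R : realType) (c C tau beta u : R) :
  0 < c -> 1 <= C * c -> 0 < C -> 0 < tau -> tau < 1 -> 2 <= beta ->
  c * tau <= u ->
  C ^+ 2 * u ^+ 2 <=
    C `^ beta * (tau ^ (- Num.floor beta - 1) / (1 - tau)) * u `^ beta.
Proof.
move=> c0 Cc C0 t0 t1 b2 ctu.
have ct0 : 0 < c * tau by rewrite mulr_gt0.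
have u0 : 0 < u by exact: lt_le_trans ctu.
have [cp tp Cp up] : [/\ 0 <= c, 0 <= tau, 0 <= C & 0 <= u].
  by split; exact: ltW.
set F := _ / _.
have split x : 0 < x -> x `^ beta = x ^+ 2 * x `^ (beta - 2).
  move=> x0; rewrite -powR_mulrn ?ltW// -powRD; first by congr (_ `^ _); ring.
  by rewrite [x == 0]gt_eqF// implybT.
have F1 : 1 <= F * tau `^ (beta - 2) by apply: tau_factor_ge1 => //; lra.
have F0 : 0 <= F by rewrite divr_ge0 ?exprz_ge0 ?ltW// subr_gt0.
have Cc1 : 1 <= (C * c) `^ (beta - 2).
  by rewrite -[leLHS](powRr0 (C * c)) ler_powR//; lra.
have ub : c `^ (beta - 2) * tau `^ (beta - 2) <= u `^ (beta - 2).
  by rewrite -powRM// ge0_ler_powR ?nnegrE ?mulr_ge0//; lra.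
have key : 1 <= C `^ (beta - 2) * F * u `^ (beta - 2).
  apply: (@le_trans _ _ (C `^ (beta - 2) * F *
      (c `^ (beta - 2) * tau `^ (beta - 2)))).
    rewrite mulrACA -powRM// mulr_ege1//.
  by rewrite ler_wpM2l// mulr_ge0 ?powR_ge0.
rewrite !split//.
have -> : C ^+ 2 * C `^ (beta - 2) * F * (u ^+ 2 * u `^ (beta - 2)) =
  (C ^+ 2 * u ^+ 2) * (C `^ (beta - 2) * F * u `^ (beta - 2)) by ring.
by rewrite ler_peMr// mulr_ge0// sqr_ge0.
Qed.

Theorem lemma3 (R : realType) :
  exists c C1 C2 C3 : R,
    [/\ 0 < c, 0 < C1, 0 < C2 & 0 < C3] /\
    forall (d : measure_display) (T : measurableType d) (P : probability T R)
      (alpha sigma L : R) (X : {RV P >-> R}),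
      1 <= alpha ->
      0 < sigma ->
      sigma <= L ->
      ('E_P[X] = 0)%E ->
      (forall k : nat, (2 <= k)%N ->
         ('E_P[fun w => (`|X w| ^+ k)%R] <=
            (k%:R `^ (k%:R / alpha) * sigma ^+ 2 * L ^+ (k - 2))%:E)%E) ->
      [/\
         2 <= alpha ->
         (forall lambda : R, 0 <= lambda -> lambda <= c / L ->
            ('E_P[fun w => expR (lambda * X w)] <=
               (expR (C1 * lambda ^+ 2 * sigma ^+ 2))%:E)%E) /\
         (forall beta : R, alpha^-1 + beta^-1 = 1 ->
          forall lambda : R, 0 <= lambda ->
            ('E_P[fun w => expR (lambda * X w)] <=
               (expR (C2 * Num.min (lambda `^ beta * L `^ beta)
                                   (lambda ^+ 2 * L ^+ 2)))%:E)%E),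
         1 < alpha -> alpha <= 2 ->
         (forall lambda : R, 0 <= lambda -> lambda <= c / L ->
            ('E_P[fun w => expR (lambda * X w)] <=
               (expR (C1 * lambda ^+ 2 * sigma ^+ 2))%:E)%E) /\
         (forall beta : R, alpha^-1 + beta^-1 = 1 ->
          forall tau : R, 0 < tau -> tau < 1 ->
          forall lambda : R, c * tau / L <= lambda ->
            ('E_P[fun w => expR (lambda * X w)] <=
               (expR (C3 `^ beta *
                      (tau ^ (- Num.floor beta - 1) / (1 - tau)) *
                      lambda `^ beta * L `^ beta))%:E)%E)
       & alpha = 1 ->
         forall lambda : R, 0 <= lambda -> lambda <= c / L ->
            ('E_P[fun w => expR (lambda * X w)] <=
               (expR (C1 * lambda ^+ 2 * sigma ^+ 2))%:E)%E ].
Proof.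
pose e : R := expR 1; have e0 : 0 < e by exact: expR_gt0.
have e1 : 1 < e by rewrite expR_gt1.
have ep : 0 <= e by exact: ltW.
have e2p : 0 <= 2 * e by rewrite mulr_ge0.
pose c := (2 * e)^-1; have c0 : 0 < c by rewrite invr_gt0 mulr_gt0.
exists c, (2 * e ^+ 2), (12 * e ^+ 2), (6 * e).
split; first by split => //; rewrite mulr_gt0// exprn_gt0.
move=> d T P alpha sigma L X a1 s0 sL EX0 EXk.
have L0 : 0 < L by exact: lt_le_trans sL.
have Lp : 0 <= L by exact: ltW.
have small lambda : 0 <= lambda -> lambda <= c / L ->
    ('E_P[fun w => expR (lambda * X w)] <=
      (expR (2 * e ^+ 2 * lambda ^+ 2 * sigma ^+ 2))%:E)%E.
  by move=> l0 lc; exact: (mgf_gaussian_regime a1 s0 sL EX0 EXk l0 lc).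
have smallL lambda : 2 * e ^+ 2 * lambda ^+ 2 * sigma ^+ 2 <=
    2 * e ^+ 2 * (lambda * L) ^+ 2.
  have -> : 2 * e ^+ 2 * (lambda * L) ^+ 2 = 2 * e ^+ 2 * lambda ^+ 2 * L ^+ 2.
    by ring.
  apply: ler_wpM2l; first by rewrite mulr_ge0 ?sqr_ge0// mulr_ge0 ?sqr_ge0.
  by rewrite ler_pXn2r ?nnegrE// ltW.
split => [a2|a_gt1 a2|_]; [split => //|split => //|by []].
- move=> beta ab lambda l0.
  have b0 : 0 < beta by apply: (conjugate_exponent_gt0 _ ab); lra.
  have b2 : beta <= 2.
    rewrite -[leRHS]invrK -[leLHS]invrK lef_pV2 ?posrE ?invr_gt0//.
    have : alpha^-1 <= 2^-1 by rewrite lef_pV2 ?posrE//; lra.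
    lra.
  rewrite -powRM// -exprMn; set u := lambda * L.
  have u0 : 0 <= u by rewrite mulr_ge0// ltW.
  have [lc|/ltW cl] := leP lambda (c / L).
    apply: le_trans (small _ l0 lc) _; rewrite lee_fin ler_expR.
    apply: le_trans (smallL _) _; rewrite -/u.
    have u1 : u <= 1.
      apply: (@le_trans _ _ c); first by rewrite -ler_pdivlMr.
      by rewrite invf_le1 ?mulr_gt0//; lra.
    have -> : Num.min (u `^ beta) (u ^+ 2) = u ^+ 2.
      apply/min_idPr; move: u0; rewrite le_eqVlt => /orP[/eqP <-|u0].
        by rewrite expr0n powR_ge0.
      by rewrite -powR_mulrn ?(ltW u0)// ger_powR// u0.
    by rewrite ler_wpM2r ?sqr_ge0// ler_wpM2r ?sqr_ge0//; lra.
  apply: le_trans (mgf_conjugate_regime a1 s0 sL EX0 EXk b0 ab cl) _.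
  rewrite lee_fin ler_expR -/e -/u.
  have v1 : 1 <= 2 * e * u.
    rewrite ler_pdivrMr// in cl.
    by rewrite -ler_pdivrMl ?mulr_gt0// mulr1.
  have Wb : (2 * e * u) `^ beta <= 4 * e ^+ 2 * u `^ beta.
    rewrite powRM// ler_wpM2r ?powR_ge0//.
    have -> : 4 * e ^+ 2 = (2 * e) `^ 2%:R.
      by rewrite powR_mulrn// exprMn; ring.
    by rewrite ler_powR//; lra.
  have W2 : (2 * e * u) `^ beta <= 4 * e ^+ 2 * u ^+ 2.
    have -> : 4 * e ^+ 2 * u ^+ 2 = (2 * e * u) `^ 2%:R.
      by rewrite powR_mulrn ?mulr_ge0// !exprMn; ring.
    by rewrite ler_powR.
  rewrite /Num.min; case: ifP => _; lra.
- move=> beta ab tau t0 t1 lambda ctl.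
  have b0 : 0 < beta by exact: (conjugate_exponent_gt0 a_gt1 ab).
  have b2 : 2 <= beta.
    rewrite -[leRHS]invrK -[leLHS]invrK lef_pV2 ?posrE ?invr_gt0//.
    have : 2^-1 <= alpha^-1 by rewrite lef_pV2 ?posrE//; lra.
    lra.
  have l0 : 0 <= lambda.
    by apply: le_trans ctl; rewrite divr_ge0 ?mulr_ge0 ?ltW.
  rewrite -mulrA -powRM//.
  rewrite ler_pdivrMr// in ctl.
  have [lc|/ltW cl] := leP lambda (c / L).
    apply: le_trans (small _ l0 lc) _; rewrite lee_fin ler_expR.
    apply: le_trans (smallL _) _.
    have Cc : 1 <= 6 * e * c.
      have -> : 6 * e * c = 3 by rewrite /c; field; rewrite gt_eqF.
      by lra.
    apply: le_trans (sq_le_tau_powR c0 Cc _ t0 t1 b2 ctl).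
      by rewrite ler_wpM2r ?sqr_ge0//; nra.
    by rewrite mulr_gt0.
  apply: le_trans (mgf_conjugate_regime a1 s0 sL EX0 EXk b0 ab cl) _.
  rewrite lee_fin ler_expR -/e; set u := lambda * L.
  have u0 : 0 <= u by rewrite mulr_ge0// ltW.
  have F1 : 1 <= tau ^ (- Num.floor beta - 1) / (1 - tau).
    have := tau_factor_ge1 t0 t1 (ltW b0).
    by rewrite powRr0 mulr1.
  have -> : 6 * e = 3 * (2 * e) by ring.
  rewrite [(3 * _) `^ _]powRM//.
  rewrite [leLHS](_ : _ = 3 * 1 * ((2 * e) `^ beta * u `^ beta)); last first.
    by rewrite powRM// mulr1.
  set F := _ / _ in F1 *.
  have -> : 3 `^ beta * (2 * e) `^ beta * F * u `^ beta =
    3 `^ beta * F * ((2 * e) `^ beta * u `^ beta) by ring.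
  rewrite ler_wpM2r ?mulr_ge0 ?powR_ge0// ler_pM//.
  by rewrite le1r_powR//; lra.
Qed.
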